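(* There exist absolute constants $c,C>0$ and $n_0$ such that for all $n\ge n_0$, $\delta\in(0,1/2]$ and $\varepsilon\in(0,1]$ with $\varepsilon\ge c\sqrt{\log n\log(1/\delta)/n}$, there is an $(\varepsilon,\delta)$-LNDP algorithm $\mathcal{A}$ on $n$-node graphs such that for every graph $G$ on $[n]$ consisting of a clique on a set $K\subseteq[n]$ with $k^*=|K|\ge n/10$ and no other edges (all nodes outside $K$ isolated), \[ \Pr\Big[|\mathcal{A}(G)-k^*|\le C\frac{\sqrt{\log(1/\delta)}}{\varepsilon}\Big]\ge\frac23. \]
   Context: Graphs are simple and undirected on node set $[n]$; $N_i^G$ is the neighborhood of node $i$. Two graphs on $[n]$ are node neighbors if they differ only in edges incident to a single node. Random variables $R_1,R_2$ are $(\varepsilon,\delta)$-indistinguishable if for every event $Y$, $\Pr[R_1\in Y]\le e^\varepsilon\Pr[R_2\in Y]+\delta$ and symmetrically. An algorithm $\mathcal{A}$ on $n$-node graphs is (noninteractive) $(\varepsilon,\delta)$-LNDP if there exist a distribution over public random strings $\rho$, local randomizers $\mathcal{R}_{1,\rho},\dots,\mathcal{R}_{n,\rho}$ (with independent internal randomness), and a postprocessing $\mathcal{P}$ with $\mathcal{A}(G)=\mathcal{P}(\mathcal{R}_{1,\rho}(N_1^G),\dots,\mathcal{R}_{n,\rho}(N_n^G))$, such that for every fixed $\rho$ and every node-neighboring $G,G'$ the randomizer output vectors on $G$ and $G'$ are $(\varepsilon,\delta)$-indistinguishable. *)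

(* Defs.v *)
From HB Require Import structures.
From mathcomp Require Import all_boot all_order all_algebra.
From mathcomp Require Import all_classical all_reals all_analysis.
Unset Strict Implicit. Unset Printing Implicit Defensive.
Import Order.TTheory GRing.Theory Num.Theory.
Local Open Scope ring_scope.

Definition simple_graph {n : nat} (G : 'I_n -> 'I_n -> bool) : Prop :=
  (forall i j, G i j = G j i) /\ (forall i, G i i = false).

Definition nbhd {n : nat} (G : 'I_n -> 'I_n -> bool) (i : 'I_n) : {set 'I_n} :=
  [set j | G i j].

Definition node_neighbors {n : nat} (G G' : 'I_n -> 'I_n -> bool) : Prop :=
  exists v : 'I_n, forall i j, i != v -> j != v -> G i j = G' i j.

Definition clique_graph {n : nat} (K : {set 'I_n}) : 'I_n -> 'I_n -> bool :=
  fun i j => [&& i \in K, j \in K & i != j].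

Definition is_pmf {R : realType} {T : finType} (p : T -> R) : Prop :=
  (forall x, 0 <= p x) /\ \sum_(x : T) p x = 1.

(* A (noninteractive) local algorithm on n-node graphs: public randomness rho
   drawn from la_pub, local randomizers R_{i,rho} (each a pmf on messages,
   depending only on i, rho and the neighborhood N_i), and a postprocessing
   P(rho, messages) with real output. *)
Record local_alg (R : realType) (n : nat) := LocalAlg {
  la_rand : finType;
  la_msg  : finType;
  la_pub  : la_rand -> R;
  la_rzr  : la_rand -> 'I_n -> {set 'I_n} -> la_msg -> R;
  la_post : la_rand -> {ffun 'I_n -> la_msg} -> R
}.
Arguments la_rand {R n} _.
Arguments la_msg {R n} _.
Arguments la_pub {R n} _ _.
Arguments la_rzr {R n} _ _ _ _ _.
Arguments la_post {R n} _ _ _.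

Definition local_alg_wf {R : realType} {n : nat} (A : local_alg R n) : Prop :=
  is_pmf (la_pub A) /\
  forall rho i N, is_pmf (la_rzr A rho i N).

Definition msg_pmf {R : realType} {n : nat} (A : local_alg R n) (rho : la_rand A)
  (G : 'I_n -> 'I_n -> bool) (y : {ffun 'I_n -> la_msg A}) : R :=
  \prod_(i : 'I_n) la_rzr A rho i (nbhd G i) (y i).

Definition msg_prob {R : realType} {n : nat} (A : local_alg R n) (rho : la_rand A)
  (G : 'I_n -> 'I_n -> bool) (E : {set {ffun 'I_n -> la_msg A}}) : R :=
  \sum_(y in E) msg_pmf A rho G y.

Definition indist {R : realType} {T : finType} (eps delta : R)
  (P1 P2 : {set T} -> R) : Prop :=
  forall E : {set T}, P1 E <= expR eps * P2 E + delta /\ P2 E <= expR eps * P1 E + delta.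

Definition LNDP {R : realType} {n : nat} (A : local_alg R n) (eps delta : R) : Prop :=
  local_alg_wf A /\
  forall (rho : la_rand A) (G G' : 'I_n -> 'I_n -> bool),
    simple_graph G -> simple_graph G' -> node_neighbors G G' ->
    indist eps delta (msg_prob A rho G) (msg_prob A rho G').

Definition out_prob {R : realType} {n : nat} (A : local_alg R n)
  (G : 'I_n -> 'I_n -> bool) (S : R -> bool) : R :=
  \sum_(rho : la_rand A) la_pub A rho *
    \sum_(y : {ffun 'I_n -> la_msg A} | S (la_post A rho y)) msg_pmf A rho G y.

(* Main.v *)
(* Each node of degree d publishes one bit whose mean is eps/8 times a public
   random function of d: the piecewise linear interpolation of independent
   uniform signs placed at the multiples of W ~ sqrt (n ln (1/delta)).  The bias
   is at most eps/8, so the rewired node costs a factor exp (eps/2); the other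
   biases move by at most eps/(4 W), so their total log-likelihood ratio stays
   below eps/2 except with probability delta.  For decoding, let S_b be the
   correlation of the bits with the b-th signs.  On a k-clique only the two
   knots around k - 1 have a correlation S_b with nonzero mean, and every other
   S_b is a sum of fair signs, so Chernoff and a union bound (here eps^2 n must
   dominate ln n) locate the knot; then S_(b+1) - S_(b-1) has mean
   (eps/8) k (k - 1 - b W) / W, and its O(sqrt n) fluctuation determines k up
   to O(W / (eps sqrt n)).  Isolated nodes only affect S_0, which is not
   eligible. *)

Require Import Defs.
From HB Require Import structures.
From mathcomp Require Import all_boot all_order all_algebra.
From mathcomp Require Import all_classical all_reals all_analysis.
From mathcomp Require Import ring lra zify.
Import Order.TTheory GRing.Theory Num.Theory.
Local Open Scope ring_scope.

(** * Biased bits and their likelihood ratios *)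

Definition bsign {R : realType} (b : bool) : R := (-1) ^+ b.

Lemma normr_bsign (R : realType) (b : bool) : `|bsign b : R| = 1.
Proof. by rewrite /bsign normrX normrN1 expr1n. Qed.

Definition rr {R : realType} (q : R) (y : bool) : R := (1 + bsign y * q) / 2.

Lemma sum_rr {R : realType} (q : R) (g : bool -> R) :
  \sum_(y : bool) rr q y * g y
  = (1 - q) / 2 * g true + (1 + q) / 2 * g false.
Proof. by rewrite big_bool /rr /bsign /= expr0 expr1 mulN1r mul1r. Qed.

Lemma rr_ge0 {R : realType} (q : R) (y : bool) : `|q| <= 1 -> 0 <= rr q y.
Proof.
rewrite ler_norml => /andP[? ?].
by case: y; rewrite /rr /bsign ?expr0 ?expr1; lra.
Qed.

Lemma is_pmf_rr {R : realType} (q : R) : `|q| <= 1 -> is_pmf (rr q).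
Proof.
move=> q1; split=> [y|]; first exact: rr_ge0.
by rewrite big_bool /rr /bsign /=; field.
Qed.

Lemma expR_ge1 {R : realType} (x : R) : 0 <= x -> 1 <= expR x.
Proof. by move=> x0; have := expR_ge1Dx x; lra. Qed.

(** Follows from [expR x * (1 - x) <= 1], because [(1 + x + 2 * x ^+ 2) * (1 - x) = 1 + x ^+ 2 * (1
    - 2 * x)] is at least 1. *)
Lemma expR_le_quad {R : realType} (x : R) :
  x <= 2^-1 -> expR x <= 1 + x + 2 * x ^+ 2.
Proof.
move=> x2.
have h : expR x * (1 - x) <= 1.
  rewrite -[leRHS](expRxMexpNx_1 x) ler_wpM2l ?expR_ge0 //.
  exact: (expR_ge1Dx (- x)).
have x1 : 0 < 1 - x by lra.
rewrite -ler_pdivlMr // div1r in h.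
apply: le_trans h _; rewrite -div1r ler_pdivrMr //.
have -> : (1 + x + 2 * x ^+ 2) * (1 - x) = 1 + x ^+ 2 * (1 - 2 * x) by ring.
by rewrite lerDl mulr_ge0 ?sqr_ge0; lra.
Qed.

(* First-order upper bound on ln (rr q y / rr q' y). *)
Definition llr {R : realType} (q q' : R) (y : bool) : R :=
  bsign y * (q - q') / (1 + bsign y * q').

Lemma rr_le_llr {R : realType} (q q' : R) (y : bool) :
  `|q'| <= 8^-1 -> rr q y <= rr q' y * expR (llr q q' y).
Proof.
rewrite ler_norml => /andP[? ?].
have pos : 0 < 1 + bsign y * q'.
  by case: y; rewrite /bsign ?expr0 ?expr1; lra.
have -> : rr q y = rr q' y * (1 + llr q q' y).
  by rewrite /rr /llr; field; rewrite gt_eqF.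
rewrite ler_wpM2l ?expR_ge1Dx // /rr divr_ge0 ?ltW //.
Qed.

(** Under [q] the mean of [llr q q'] is [(q - q') ^+ 2 / (1 - q' ^+ 2)]: the part linear in [q - q']
    cancels. This is why the exponent is quadratic in [eta]. *)
Lemma rr_llr_mgf {R : realType} (q q' eta lam : R) :
  `|q| <= 8^-1 -> `|q'| <= 8^-1 -> `|q - q'| <= eta ->
  0 <= lam -> lam * eta <= 4^-1 ->
  \sum_(y : bool) rr q y * expR (lam * llr q q' y)
  <= expR (8 * lam * (1 + lam) * eta ^+ 2).
Proof.
move=> hq hq' hd l0 le4.
have eta0 : 0 <= eta by apply: le_trans hd; exact: normr_ge0.
have llr_small y : `|llr q q' y| <= 2 * eta.
  rewrite /llr normrM normrM normr_bsign mul1r normfV.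
  have den : 2^-1 <= `|1 + bsign y * q'|.
    move: hq'; rewrite ler_norml => /andP[? ?].
    apply: le_trans (ler_norm _).
    by case: y; rewrite /bsign ?expr0 ?expr1; lra.
  rewrite ler_pdivrMr; last by lra.
  apply: (le_trans hd).
  rewrite -[leLHS]mulr1 [2 * eta]mulrC -mulrA ler_wpM2l //; lra.
have step y : rr q y * expR (lam * llr q q' y)
    <= rr q y * (1 + lam * llr q q' y + 8 * lam ^+ 2 * eta ^+ 2).
  rewrite ler_wpM2l ?rr_ge0 //; first by apply: le_trans hq _; lra.
  have llr2 : llr q q' y ^+ 2 <= 4 * eta ^+ 2.
    rewrite -real_normK ?num_real //.
    have -> : 4 * eta ^+ 2 = (2 * eta) ^+ 2 by ring.
    by rewrite lerXn2r ?nnegrE //; lra.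
  apply: le_trans (expR_le_quad _ _) _.
    have : lam * llr q q' y <= lam * (2 * eta).
      by rewrite ler_wpM2l // (le_trans (ler_norm _)).
    by lra.
  rewrite lerD2l exprMn.
  have := ler_wpM2l (sqr_ge0 lam) llr2; lra.
apply: le_trans (ler_sum _ (fun y _ => step y)) _.
apply: le_trans (expR_ge1Dx _).
rewrite sum_rr /llr /bsign expr0 expr1.
move: hq'; rewrite ler_norml => /andP[? ?].
set d := q - q'.
have dd : d ^+ 2 <= eta ^+ 2.
  by rewrite -(real_normK (num_real d)) lerXn2r ?nnegrE.
have -> : (1 - q) / 2 * (1 + lam * (-1 * d / (1 + -1 * q')) +
    8 * lam ^+ 2 * eta ^+ 2) + (1 + q) / 2 * (1 + lam * (1 * d / (1 + 1 * q'))
    + 8 * lam ^+ 2 * eta ^+ 2)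
  = 1 + 8 * lam ^+ 2 * eta ^+ 2 + lam * (d ^+ 2 / (1 - q' ^+ 2)).
  have -> : q = q' + d by rewrite /d; ring.
  rewrite (_ : 1 - q' ^+ 2 = (1 - q') * (1 + q')); last by ring.
  have a1 : 1 + q' != 0 by rewrite gt_eqF //; lra.
  have a2 : 1 - q' != 0 by rewrite gt_eqF //; lra.
  rewrite mulN1r mul1r; field; exact/andP.
have : d ^+ 2 / (1 - q' ^+ 2) <= 8 * eta ^+ 2.
  have q2 : q' ^+ 2 <= 2^-1.
    have : 0 <= (8^-1 - q') * (q' + 8^-1) by apply: mulr_ge0; lra.
    by lra.
  rewrite ler_pdivrMr; last by lra.
  apply: le_trans dd _.
  have : 0 <= eta ^+ 2 * (2^-1 - q' ^+ 2) by rewrite mulr_ge0 ?sqr_ge0; lra.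
  by have := sqr_ge0 eta; lra.
move=> /(ler_wpM2l l0); lra.
Qed.

(** * Indistinguishability of products of biased bits *)

Lemma expR_half_ratio {R : realType} (eps : R) :
  0 <= eps -> eps <= 1 -> (1 + eps / 8) <= (1 - eps / 8) * expR (eps / 2).
Proof.
move=> e0 e1; have := expR_ge1Dx (eps / 2); nra.
Qed.

(* Only the coordinates i != v enter the exponent llr: these are small but
   many, while coordinate v costs a factor expR (eps / 2) outright. *)
Lemma rr_prod_indist {R : realType} (n : nat) (q q' : 'I_n -> R) (v : 'I_n)
    (eta eps lam : R) (E : {set {ffun 'I_n -> bool}}) :
  0 <= eps -> eps <= 1 ->
  (forall i, `|q i| <= eps / 8) -> (forall i, `|q' i| <= eps / 8) ->
  (forall i, i != v -> `|q i - q' i| <= eta) ->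
  0 <= eta -> 0 <= lam -> lam * eta <= 4^-1 ->
  \sum_(y in E) \prod_i rr (q i) (y i)
  <= expR eps * (\sum_(y in E) \prod_i rr (q' i) (y i))
     + expR (8 * lam * (1 + lam) * eta ^+ 2 * n%:R - lam * (eps / 2)).
Proof.
move=> e0 e1 hq hq' hd eta0 l0 le4.
have q8 i : `|q i| <= 8^-1 by apply: le_trans (hq i) _; lra.
have q'8 i : `|q' i| <= 8^-1 by apply: le_trans (hq' i) _; lra.
have rr0 i y : 0 <= rr (q i) y by apply: rr_ge0; apply: le_trans (q8 i) _; lra.
have rr'0 i y : 0 <= rr (q' i) y by apply: rr_ge0; apply: le_trans (q'8 i) _; lra.
pose xi (i : 'I_n) y := if i == v then 0 else llr (q i) (q' i) y.
pose X (y : {ffun 'I_n -> bool}) := \sum_i xi i (y i).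
have ratio (y : {ffun 'I_n -> bool}) :
    \prod_i rr (q i) (y i) <= (\prod_i rr (q' i) (y i)) * expR (X y + eps / 2).
  have -> : X y + eps / 2 = \sum_i (xi i (y i) + if i == v then eps / 2 else 0).
    by rewrite big_split /= -big_mkcond /= big_pred1_eq.
  rewrite expR_sum -big_split /=; apply: ler_prod => i _.
  rewrite rr0 /= /xi; case: eqP => [_|_]; last first.
    by rewrite addr0; exact: rr_le_llr.
  rewrite add0r.
  have key := expR_half_ratio eps e0 e1.
  have abs_le (x : R) : `|x| <= eps / 8 -> - (eps / 8) <= bsign (y i) * x <= eps / 8.
    by rewrite -ler_norml normrM normr_bsign mul1r.
  have /andP[_ up] := abs_le _ (hq i); have /andP[lo _] := abs_le _ (hq' i).
  have : (1 - eps / 8) * expR (eps / 2) <= (1 + bsign (y i) * q' i) * expR (eps / 2).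
    by rewrite ler_wpM2r ?expR_ge0 //; lra.
  by rewrite /rr; lra.
have P0 (y : {ffun 'I_n -> bool}) : 0 <= \prod_i rr (q i) (y i).
  by apply: prodr_ge0.
have P'0 (y : {ffun 'I_n -> bool}) : 0 <= \prod_i rr (q' i) (y i).
  by apply: prodr_ge0.
(* Markov's inequality, pointwise: if [X y <= eps / 2] the first term suffices, otherwise the
   exponential factor in the second is at least 1. *)
have point (y : {ffun 'I_n -> bool}) : \prod_i rr (q i) (y i)
    <= expR eps * (\prod_i rr (q' i) (y i))
       + (\prod_i rr (q i) (y i)) * expR (lam * (X y - eps / 2)).
  have [small|big] := leP (X y) (eps / 2).
    apply: le_trans (ratio y) _.
    rewrite mulrC -[leLHS]addr0 lerD ?mulr_ge0 ?expR_ge0 //.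
    by rewrite ler_wpM2r // ler_expR; lra.
  rewrite -[leLHS]add0r lerD ?mulr_ge0 ?expR_ge0 //.
  rewrite ler_peMr ?expR_ge1 ?mulr_ge0 //; lra.
apply: le_trans (ler_sum _ (fun y _ => point y)) _.
rewrite big_split /= -mulr_sumr lerD2l.
(* The tail term is enlarged from [E] to all outputs, so that it factors over the coordinates. *)
apply: (@le_trans _ _ (\sum_(y : {ffun 'I_n -> bool})
   (\prod_i rr (q i) (y i)) * expR (lam * (X y - eps / 2)))).
  rewrite big_mkcond /=; apply: ler_sum => y _.
  by case: ifP => // _; rewrite mulr_ge0 ?expR_ge0.
have -> : \sum_(y : {ffun 'I_n -> bool})
    (\prod_i rr (q i) (y i)) * expR (lam * (X y - eps / 2))
  = (\prod_i \sum_(y : bool) rr (q i) y * expR (lam * xi i y))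
    * expR (- (lam * (eps / 2))).
  rewrite bigA_distr_bigA mulr_suml; apply: eq_bigr => y _.
  by rewrite [X in _ = X * _]big_split /= -expR_sum -mulrA -expRD -mulr_sumr mulrBr.
rewrite expRD ler_wpM2r ?expR_ge0 //.
rewrite [X in expR X]mulrC expRM_natl -[n in X in _ <= X]card_ord -prodr_const.
apply: ler_prod => i _; rewrite sumr_ge0 => [/=|y _]; last first.
  by rewrite mulr_ge0 ?expR_ge0.
rewrite /xi; case: eqP => [_|/eqP iv]; last by apply: rr_llr_mgf => //; exact: hd.
under eq_bigr do rewrite mulr0 expR0.
rewrite sum_rr.
apply: (@le_trans _ _ 1); first by lra.
by rewrite expR_ge1 // !mulr_ge0 ?sqr_ge0 //; lra.
Qed.

(** * Expectations and exponential moments *)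

(* The joint law of independent pairs (r_i, y_i), with r_i uniform on T and
   y_i drawn from rr (q i r_i). *)
Definition expect {R : realType} {n : nat} {T : finType} (q : 'I_n -> T -> R)
    (f : {ffun 'I_n -> T} -> {ffun 'I_n -> bool} -> R) : R :=
  \sum_(rho : {ffun 'I_n -> T}) #|T|%:R^-1 ^+ n *
    \sum_(y : {ffun 'I_n -> bool}) (\prod_i rr (q i (rho i)) (y i)) * f rho y.

Definition expect1 {R : realType} {T : finType} (q : T -> R)
    (g : T -> bool -> R) : R :=
  \sum_(r : T) #|T|%:R^-1 * \sum_(y : bool) rr (q r) y * g r y.

Section Expectation.
Context {R : realType} {n : nat} {T : finType}.
Implicit Types (q : 'I_n -> T -> R) (f : {ffun 'I_n -> T} -> {ffun 'I_n -> bool} -> R).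

Lemma expect_prod q (g : 'I_n -> T -> bool -> R) :
  expect q (fun rho y => \prod_i g i (rho i) (y i)) = \prod_i expect1 (q i) (g i).
Proof.
rewrite /expect /expect1 bigA_distr_bigA; apply: eq_bigr => rho _.
rewrite [RHS]big_split /= prodr_const card_ord bigA_distr_bigA; congr (_ * _).
by apply: eq_bigr => y _; rewrite [RHS]big_split.
Qed.

Lemma expect_le q f f' : (forall i r, `|q i r| <= 1) ->
  (forall rho y, f rho y <= f' rho y) -> expect q f <= expect q f'.
Proof.
move=> q1 ff'; apply: ler_sum => rho _.
rewrite ler_wpM2l ?exprn_ge0 ?invr_ge0 ?ler0n //.
apply: ler_sum => y _; rewrite ler_wpM2l // prodr_ge0 // => i _.
exact: rr_ge0.
Qed.

Lemma expectZ q a f : expect q (fun rho y => a * f rho y) = a * expect q f.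
Proof.
rewrite /expect mulr_sumr; apply: eq_bigr => rho _.
rewrite mulrCA; congr (_ * _); rewrite mulr_sumr; apply: eq_bigr => y _.
by rewrite mulrCA.
Qed.

Lemma expect_sum q (I : Type) (s : seq I) (P : pred I) (F : I -> _ -> _ -> R) :
  expect q (fun rho y => \sum_(j <- s | P j) F j rho y)
  = \sum_(j <- s | P j) expect q (F j).
Proof.
rewrite /expect exchange_big; apply: eq_bigr => rho _ /=.
rewrite -mulr_sumr exchange_big; congr (_ * _); apply: eq_bigr => y _ /=.
by rewrite mulr_sumr.
Qed.

Lemma expectB q f f' :
  expect q (fun rho y => f rho y - f' rho y) = expect q f - expect q f'.
Proof.
rewrite /expect -sumrB; apply: eq_bigr => rho _.
rewrite -mulrBr -sumrB; congr (_ * _); apply: eq_bigr => y _.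
by rewrite mulrBr.
Qed.

Lemma expect1_cst (q : T -> R) (a : R) : (0 < #|T|)%N ->
  expect1 q (fun _ _ => a) = a.
Proof.
move=> T0; rewrite /expect1.
under eq_bigr => r _ do rewrite sum_rr.
transitivity (\sum_(r : T) #|T|%:R^-1 * a); first by apply: eq_bigr => r _; congr (_ * _); lra.
rewrite -mulr_suml sumr_const -[_^-1 *+ _]mulr_natr mulVf ?mul1r ?pnatr_eq0 -?lt0n //.
Qed.

Lemma expect_cst q (a : R) : (0 < #|T|)%N -> expect q (fun _ _ => a) = a.
Proof.
move=> T0; rewrite -[a in LHS]mulr1 expectZ.
have -> : expect q (fun _ _ => 1) = expect q (fun _ _ => \prod_(i < n) 1).
  by congr expect; apply/funext => rho; apply/funext => y; rewrite big1.
by rewrite (expect_prod q (fun _ _ _ => 1)) big1 ?mulr1 // => i _; exact: expect1_cst.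
Qed.

Lemma expect1D (q : T -> R) g g' :
  expect1 q (fun r y => g r y + g' r y) = expect1 q g + expect1 q g'.
Proof.
rewrite /expect1 -big_split; apply: eq_bigr => r _ /=.
rewrite -mulrDr -big_split; congr (_ * _); apply: eq_bigr => y _ /=.
by rewrite mulrDr.
Qed.

Lemma expect1Z (q : T -> R) a g :
  expect1 q (fun r y => a * g r y) = a * expect1 q g.
Proof.
rewrite /expect1 mulr_sumr; apply: eq_bigr => r _.
rewrite mulrCA; congr (_ * _); rewrite mulr_sumr; apply: eq_bigr => y _.
by rewrite mulrCA.
Qed.

Lemma expect1_le (q : T -> R) g g' : (forall r, `|q r| <= 1) ->
  (forall r y, g r y <= g' r y) -> expect1 q g <= expect1 q g'.
Proof.
move=> q1 gg'; apply: ler_sum => r _.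
rewrite ler_wpM2l ?invr_ge0 ?ler0n //.
by apply: ler_sum => y _; rewrite ler_wpM2l ?rr_ge0.
Qed.

(** Centering at [mu] removes the linear term of [expR_le_quad], leaving only the quadratic one. *)
Lemma expect1_mgf (q : T -> R) g (mu M lam : R) :
  (0 < #|T|)%N -> (forall r, `|q r| <= 1) ->
  expect1 q g = mu -> (forall r y, `|g r y - mu| <= M) ->
  0 <= lam -> lam * M <= 2^-1 ->
  expect1 q (fun r y => expR (lam * (g r y - mu))) <= expR (2 * (lam * M) ^+ 2).
Proof.
move=> T0 q1 gmu gM l0 lM.
apply: le_trans (expR_ge1Dx _).
have -> : 1 + 2 * (lam * M) ^+ 2
  = expect1 q (fun r y => lam * g r y + (1 - lam * mu + 2 * (lam * M) ^+ 2)).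
  by rewrite expect1D expect1Z gmu expect1_cst //; ring.
apply: expect1_le => // r y.
have h : `|lam * (g r y - mu)| <= lam * M.
  by rewrite normrM ger0_norm // ler_wpM2l.
apply: le_trans (expR_le_quad _ _) _.
  by apply: le_trans (ler_norm _) _; apply: le_trans h _.
have : (lam * (g r y - mu)) ^+ 2 <= (lam * M) ^+ 2.
  rewrite -real_normK ?num_real // lerXn2r ?nnegrE //.
  exact: le_trans h.
lra.
Qed.

(** Kept as an exponential moment instead of a tail probability, so that [expect_union] can add up
    such bounds directly. *)
Lemma expect_chernoff q (Z : 'I_n -> T -> bool -> R) (mu : 'I_n -> R)
    (m t M lam : R) :
  (0 < #|T|)%N -> (forall i r, `|q i r| <= 1) ->
  (forall i, expect1 (q i) (Z i) = mu i) ->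
  (forall i r y, `|Z i r y - mu i| <= M) ->
  \sum_i mu i = m ->
  0 <= lam -> lam * M <= 2^-1 ->
  expect q (fun rho y => expR (lam * (\sum_i Z i (rho i) (y i) - m - t)))
  <= expR (2 * (lam * M) ^+ 2 * n%:R - lam * t).
Proof.
move=> T0 q1 Zmu ZM <- l0 lM.
have -> : expect q (fun rho y =>
    expR (lam * (\sum_i Z i (rho i) (y i) - \sum_i mu i - t)))
  = expR (- (lam * t)) *
    expect q (fun rho y => \prod_i expR (lam * (Z i (rho i) (y i) - mu i))).
  rewrite -expectZ; congr expect; apply/funext => rho; apply/funext => y.
  rewrite -expR_sum -mulr_sumr sumrB -expRD; congr expR; ring.
rewrite (expect_prod q (fun i r y => expR (lam * (Z i r y - mu i)))).
rewrite [leRHS]expRD mulrC ler_wpM2r ?expR_ge0 //.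
rewrite [X in expR X]mulrC expRM_natl -[n in X in _ <= X]card_ord -prodr_const.
apply: ler_prod => i _; rewrite expect1_mgf // andbT.
rewrite -(expect1_cst (q i) 0 T0); by apply: expect1_le.
Qed.

End Expectation.

(** * Random waves and their correlations with the knots *)

Definition knot {R : realType} {m : nat} (r : {ffun 'I_m.+1 -> bool}) (c : nat) : R :=
  bsign (r (inord c)).

(* Linear interpolation of the random signs knot r 0, knot r 1, etc., placed at
   the multiples of W. *)
Definition wave {R : realType} {m : nat} (W : nat) (alpha : R)
    (r : {ffun 'I_m.+1 -> bool}) (d : nat) : R :=
  alpha * ((1 - (d %% W)%:R / W%:R) * knot r (d %/ W)
           + (d %% W)%:R / W%:R * knot r (d %/ W).+1).

(** The tent function with peak 1 at [c * W]: the coefficient of [knot r c] in [wave W 1 r d]. *)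
Definition hat {R : realType} (W c d : nat) : R :=
  (1 - (d %% W)%:R / W%:R) * (c == d %/ W)%N%:R
  + (d %% W)%:R / W%:R * (c == (d %/ W).+1)%N%:R.

Section Wave.
Context {R : realType} {m : nat} (W : nat).
Hypothesis W0 : (0 < W)%N.
Implicit Types (r : {ffun 'I_m.+1 -> bool}) (alpha : R).

Lemma frac_itv d : 0 <= (d %% W)%:R / W%:R :> R /\ (d %% W)%:R / W%:R <= 1 :> R.
Proof.
split; first by rewrite divr_ge0.
by rewrite ler_pdivrMr ?ltr0n // mul1r ler_nat ltnW // ltn_mod.
Qed.

Lemma normr_knot r c : `|knot r c : R| = 1.
Proof. exact: normr_bsign. Qed.

Lemma normr_wave alpha r d : 0 <= alpha -> `|wave W alpha r d| <= alpha.
Proof.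
move=> a0; have [t0 t1] := frac_itv d; rewrite /wave.
move: (_ / _) t0 t1 => t t0 t1.
rewrite normrM ger0_norm // -[leRHS]mulr1 ler_wpM2l //.
apply: le_trans (ler_normD _ _) _.
by rewrite !normrM !normr_knot !ger0_norm ?mulr1; lra.
Qed.

(** Both [d] and [d.+1] lie on one linear piece, whose slope is [alpha / W] times a difference of
    two signs. *)
Lemma wave_step alpha r d : 0 <= alpha ->
  `|wave W alpha r d.+1 - wave W alpha r d| <= 2 * alpha / W%:R.
Proof.
move=> a0.
have WR : (W%:R : R) != 0 by rewrite pnatr_eq0 -lt0n.
have -> : wave W alpha r d.+1 - wave W alpha r d
    = alpha / W%:R * (knot r (d %/ W).+1 - knot r (d %/ W)).
  have [b [t [tW ->]]] : exists b t, (t < W)%N /\ d = (b * W + t)%N.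
    by exists (d %/ W)%N, (d %% W)%N; rewrite ltn_mod -divn_eq.
  rewrite -addnS /wave.
  rewrite !divnMDl // !modnMDl !(divn_small tW) !(modn_small tW) addn0.
  have [tW1|tW1] := ltnP t.+1 W.
    rewrite (divn_small tW1) (modn_small tW1) addn0 -[t.+1]addn1 natrD.
    by field.
  (* Here [d.+1] is the next multiple of [W]: quotient and remainder jump, but the two adjacent
     pieces agree at the knot. *)
  have -> : t.+1 = W by lia.
  have tR : (t%:R : R) = W%:R - 1.
    by rewrite (_ : W = t.+1) -?natr1 ?addrK //; lia.
  by rewrite divnn W0 modnn addn1 tR; field.
rewrite normrM ger0_norm ?divr_ge0 // -mulrA -mulrA [2 * _]mulrC mulrA.
rewrite ler_wpM2l ?divr_ge0 //.
by apply: le_trans (ler_normB _ _) _; rewrite !normr_knot; lra.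
Qed.

Lemma normr_wave_sub alpha r d d' : 0 <= alpha -> (d <= d'.+1)%N -> (d' <= d.+1)%N ->
  `|wave W alpha r d - wave W alpha r d'| <= 2 * alpha / W%:R.
Proof.
move=> a0 dd' d'd.
have [->|->|->] : [\/ d = d'.+1, d' = d.+1 | d = d'].
  have [|] : (d = d'.+1 \/ d = d') \/ d' = d.+1 by lia.
    by case; [constructor 1|constructor 3].
  by constructor 2.
- exact: wave_step.
- by rewrite distrC; exact: wave_step.
- by rewrite subrr normr0 divr_ge0 ?mulr_ge0.
Qed.

(** Orthogonality of the signs: for distinct knots, flipping the sign at [c] is a bijection of the
    seeds that negates the sum. *)
Lemma sum_knot_knot c c' : (c <= m)%N -> (c' <= m)%N ->
  \sum_(r : {ffun 'I_m.+1 -> bool}) #|{ffun 'I_m.+1 -> bool}|%:R^-1 * (knot r c * knot r c')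
  = (c == c')%N%:R :> R.
Proof.
move=> cm c'm; case: eqP => [<-|/eqP neq]; rewrite -mulr_sumr.
  rewrite (eq_bigr (fun=> 1)); last first.
    by move=> r _; rewrite /knot /bsign -expr2 sqrr_sign.
  rewrite sumr_const mulVf // pnatr_eq0 card_ffun card_bool card_ord.
  by rewrite -lt0n expn_gt0.
have neq' : (inord c' == inord c :> 'I_m.+1) = false.
  by rewrite -val_eqE /= !inordK // eq_sym (negbTE neq).
pose flip (r : {ffun 'I_m.+1 -> bool}) := [ffun j => (j == inord c) (+) r j].
have flipK : involutive flip.
  by move=> r; apply/ffunP => j; rewrite !ffunE addbA addbb.
set s := \sum_(_ | _) _.
have : s = - s.
  rewrite {1}/s (reindex_inj (inv_inj flipK)) -sumrN; apply: eq_bigr => r _.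
  by rewrite /knot /bsign !ffunE eqxx neq' /= signrN mulNr.
by move=> ss; rewrite (_ : s = 0) ?mulr0 //; lra.
Qed.

(** Averaging over [y] replaces [bsign y] by the wave, and orthogonality of the knots then extracts
    its coefficient at [c]. *)
Lemma expect1_knot alpha c d : (c <= m)%N -> ((d %/ W).+1 <= m)%N ->
  expect1 (fun r : {ffun 'I_m.+1 -> bool} => wave W alpha r d)
    (fun r y => knot r c * bsign y) = alpha * hat W c d.
Proof.
move=> cm dm; rewrite /expect1 /hat mulrDr !mulrA.
rewrite -!sum_knot_knot //; last exact: ltnW.
rewrite !mulr_sumr -big_split; apply: eq_bigr => r _ /=.
rewrite sum_rr /wave /bsign expr0 expr1; lra.
Qed.

End Wave.

(** Isolated nodes have degree 0, so this removes them from the mean of every correlation but that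
    at knot 0. *)
Lemma hat_first {R : realType} (W c : nat) : (0 < c)%N -> hat W c 0 = 0 :> R.
Proof.
by move=> c0; rewrite /hat div0n mod0n mul0r mul0r addr0 subr0 mul1r; case: c c0.
Qed.

Lemma hat_far {R : realType} (W c d : nat) :
  c != (d %/ W)%N -> c != (d %/ W).+1 -> hat W c d = 0 :> R.
Proof. by rewrite /hat => /negbTE-> /negbTE->; rewrite !mulr0 addr0. Qed.

Lemma hat_itv {R : realType} (W c d : nat) : (0 < W)%N -> 0 <= (hat W c d : R) <= 1.
Proof.
move=> W0; have [t0 t1] := @frac_itv R _ W0 d; rewrite /hat.
by do 2 case: eqP => _; rewrite ?mulr0 ?mulr1; lra.
Qed.

(** The same signed offset from knot [b] results on both sides of it, so the decoder need not know
    on which side the degree lies. *)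
Lemma hat_diff {R : realType} (W b d : nat) : (0 < W)%N -> (0 < b)%N ->
  b = (d %/ W)%N \/ b = (d %/ W).+1 ->
  hat W b.+1 d - hat W b.-1 d = (d%:R - b%:R * W%:R) / W%:R :> R.
Proof.
move=> W0 b0 bd.
have WR : (W%:R : R) != 0 by rewrite pnatr_eq0 -lt0n.
have dE : (d%:R : R) = (d %/ W)%:R * W%:R + (d %% W)%:R.
  by rewrite -natrM -natrD -divn_eq.
rewrite dE /hat; move: (d %% W)%N (d %/ W)%N bd => t q [] bq.
  rewrite -bq eqxx gtn_eqF // ltn_eqF ?prednK //.
  rewrite [(b.-1 == b.+1)%N]ltn_eqF; last by lia.
  by rewrite /= mulr0n mulr1n; field.
rewrite bq /= eqxx gtn_eqF // gtn_eqF // ltn_eqF //.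
by rewrite -[q.+1%:R]natr1 /= mulr0n mulr1n; field.
Qed.

(** * Degrees in cliques and in node-neighboring graphs *)

Lemma card_nbhd_clique (n : nat) (K : {set 'I_n}) (i : 'I_n) :
  #|nbhd (clique_graph K) i| = if i \in K then #|K|.-1 else 0%N.
Proof.
case: ifPn => iK.
  rewrite (cardsD1 i K) iK add1n /=; apply: eq_card => j.
  by rewrite !inE /clique_graph iK /= andbC eq_sym.
by apply: eq_card0 => j; rewrite !inE /clique_graph (negbTE iK).
Qed.

Lemma node_neighbors_degree (n : nat) (G G' : 'I_n -> 'I_n -> bool) :
  node_neighbors G G' -> exists v, forall i, i != v ->
  (#|nbhd G i| <= #|nbhd G' i|.+1)%N /\ (#|nbhd G' i| <= #|nbhd G i|.+1)%N.
Proof.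
move=> [v GG']; exists v => i iv.
rewrite (cardsD1 v (nbhd G i)) (cardsD1 v (nbhd G' i)).
have -> : nbhd G i :\ v = nbhd G' i :\ v.
  by apply/setP => j; rewrite !inE; case: eqVneq => //= jv; exact: GG'.
by split; rewrite -addSn leq_add2r; case: (v \in nbhd G i); case: (v \in nbhd G' i).
Qed.

(** * Concentration of the correlations on a clique *)

Definition corr {R : realType} {n m : nat} (rho : {ffun 'I_n -> {ffun 'I_m.+1 -> bool}})
    (y : {ffun 'I_n -> bool}) (c : nat) : R :=
  \sum_i knot (rho i) c * bsign (y i).

Definition wave_bias {R : realType} {n m : nat} (W : nat) (alpha : R)
    (G : 'I_n -> 'I_n -> bool) (i : 'I_n) (r : {ffun 'I_m.+1 -> bool}) : R :=
  wave W alpha r #|nbhd G i|.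

(** The coefficients [a] and [a'] cover both single correlations and differences of two. Each
    summand and its mean are at most 2 in absolute value, so [expect_chernoff] applies with [M = 4],
    and [32 = 2 * 4 ^+ 2]. *)
Lemma clique_chernoff {R : realType} (n W : nat) (K : {set 'I_n})
    (alpha a a' t lam : R) (c c' : nat) :
  (0 < W)%N -> 0 <= alpha -> alpha <= 1 ->
  (0 < c <= n.+2)%N -> (0 < c' <= n.+2)%N -> `|a| + `|a'| <= 2 ->
  0 <= lam -> lam <= 8^-1 ->
  expect (wave_bias (m := n.+2) W alpha (clique_graph K))
    (fun rho y => expR (lam * (a * corr rho y c + a' * corr rho y c'
       - #|K|%:R * (alpha * (a * hat W c #|K|.-1 + a' * hat W c' #|K|.-1)) - t)))
  <= expR (32 * lam ^+ 2 * n%:R - lam * t).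
Proof.
move=> W0 a0 a1 /andP[c0 cn] /andP[c'0 c'n] aa l0 l8.
have seed0 : (0 < #|{ffun 'I_n.+3 -> bool}|)%N.
  by rewrite card_ffun card_bool expn_gt0.
pose q := @wave_bias R n n.+2 W alpha (clique_graph K).
pose Z (i : 'I_n) (r : {ffun 'I_n.+3 -> bool}) y : R :=
  a * (knot r c * bsign y) + a' * (knot r c' * bsign y).
pose deg i := #|nbhd (clique_graph K) i|.
pose mu i : R := alpha * (a * hat W c (deg i) + a' * hat W c' (deg i)).
have q1 i r : `|q i r| <= 1 by apply: le_trans a1; exact: normr_wave.
have Zmu i : expect1 (q i) (Z i) = mu i.
  have deg_n : ((deg i %/ W).+1 <= n.+2)%N.
    rewrite ltnS; apply: leq_trans (leq_div _ _) _.
    by apply: leqW; rewrite -[n in X in (_ <= X)%N]card_ord max_card.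
  by rewrite expect1D !expect1Z !expect1_knot // /mu; ring.
have mu2 i : `|mu i| <= 2.
  rewrite /mu normrM ger0_norm //.
  have hat1 b d : `|hat W b d : R| <= 1.
    by have /andP[h0 h1] := @hat_itv R W b d W0; rewrite ger0_norm.
  have : `|a * hat W c (deg i) + a' * hat W c' (deg i)| <= 2.
    apply: le_trans (ler_normD _ _) _; apply: le_trans aa.
    by rewrite !normrM lerD // ler_piMr ?hat1.
  move=> h; apply: le_trans h.
  by rewrite ler_piMl.
have Z4 i r y : `|Z i r y - mu i| <= 4.
  apply: le_trans (ler_normB _ _) _.
  rewrite (_ : 4 = 2 + 2); last by ring.
  rewrite lerD // /Z; apply: le_trans (ler_normD _ _) _; apply: le_trans aa.
  by rewrite !normrM !normr_bsign !mulr1.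
have sum_mu : \sum_i mu i
    = #|K|%:R * (alpha * (a * hat W c #|K|.-1 + a' * hat W c' #|K|.-1)).
  set h := alpha * _.
  rewrite -sum1_card natr_sum mulr_suml [RHS]big_mkcond /=.
  apply: eq_bigr => i _; rewrite /mu /deg card_nbhd_clique.
  by case: ifP => _; [rewrite mul1r | rewrite !hat_first // !mulr0 addr0 mulr0].
have l4 : lam * 4 <= 2^-1 by lra.
have := expect_chernoff q Z mu _ t 4 lam seed0 q1 Zmu Z4 sum_mu l0 l4.
rewrite (_ : 2 * (lam * 4) ^+ 2 = 32 * lam ^+ 2); last by ring.
congr (_ <= _); congr expect; apply/funext => rho; apply/funext => y.
by rewrite /corr !mulr_sumr -big_split.
Qed.

(** * The decoder and the algorithm *)

(* The mean of corr (b+1) - corr (b-1) on a k-clique, valid only when k - 1 lies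
   within W of the knot b W. *)
Definition drift {R : realType} (W : nat) (alpha : R) (b k : nat) : R :=
  alpha * k%:R * (k%:R - 1 - b%:R * W%:R) / W%:R.

(** Here [b] guesses a knot next to [k - 1], where the correlation must be large, and [k] must
    explain the observed difference up to noise. Knot 0 is excluded because isolated nodes bias
    it. *)
Definition plausible {R : realType} (n W : nat) (alpha : R) (S : nat -> R)
    (b k : nat) : bool :=
  [&& (0 < b)%N, (n <= 10 * k)%N, alpha * n%:R / 40 <= S b &
      `|S b.+1 - S b.-1 - drift W alpha b k| <= 32 * Num.sqrt n%:R].

(** Any plausible pair serves; 0 is only a default. Since [b] is at most [n.+1], the index [b.+1] is
    still among the [n.+3] knots. *)
Definition decode {R : realType} (n W : nat) (alpha : R) (S : nat -> R) : R :=
  if [pick p : 'I_n.+2 * 'I_n.+1 | plausible n W alpha S p.1 p.2] is Some p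
  then (p.2 : nat)%:R else 0.

(** Each node has its own independent public signs, which makes every correlation a sum of
    independent terms. *)
Definition wave_alg (R : realType) (n W : nat) (alpha : R) : local_alg R n :=
  @LocalAlg R n {ffun 'I_n -> {ffun 'I_n.+3 -> bool}} bool
    (fun _ => #|{ffun 'I_n.+3 -> bool}|%:R^-1 ^+ n)
    (fun rho i N => rr (wave W alpha (rho i) #|N|))
    (fun rho y => decode n W alpha (corr rho y)).

Lemma out_prob_wave_alg {R : realType} (n W : nat) (alpha : R)
    (G : 'I_n -> 'I_n -> bool) (P : R -> bool) :
  out_prob (wave_alg R n W alpha) G P
  = expect (wave_bias W alpha G)
      (fun rho y => (P (decode n W alpha (corr (m := n.+2) rho y)))%:R).
Proof.
apply: eq_bigr => rho _; congr (_ * _).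
rewrite big_mkcond; apply: eq_bigr => y _ /=.
by case: ifP; rewrite /= ?mulr1 ?mulr0.
Qed.

(** * Privacy *)

Lemma wave_alg_LNDP {R : realType} (n W : nat) (eps delta : R) :
  (0 < W)%N -> 0 < eps -> eps <= 1 -> 0 < delta -> 2^-1 <= ln (delta^-1) ->
  4 * ln (delta^-1) <= W%:R -> 16 * n%:R * ln (delta^-1) <= W%:R ^+ 2 ->
  LNDP (wave_alg R n W (eps / 8)) eps delta.
Proof.
move=> W0 e0 e1 d0; set L := ln _ => L2 LW nLW.
have WR : 0 < (W%:R : R) by rewrite ltr0n.
have e8 : 0 <= eps / 8 by lra.
have bias_le (r : {ffun 'I_n.+3 -> bool}) d : `|wave W (eps / 8) r d| <= eps / 8.
  exact: normr_wave.
split.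
  split=> [|rho i N] /=; last first.
    by apply: is_pmf_rr; apply: le_trans (bias_le _ _) _; lra.
  split=> [rho|]; first by rewrite exprn_ge0 ?invr_ge0.
  rewrite sumr_const [X in _ *+ X]card_ffun card_ord -[_ *+ _]mulr_natr natrX -exprMn.
  by rewrite mulVf ?expr1n // pnatr_eq0 card_ffun card_bool -lt0n expn_gt0.
move=> rho.
suff oneside G G' (E : {set {ffun 'I_n -> bool}}) : node_neighbors G G' ->
    msg_prob (wave_alg R n W (eps / 8)) rho G E
    <= expR eps * msg_prob (wave_alg R n W (eps / 8)) rho G' E + delta.
  move=> G G' _ _ GG' E; split; apply: oneside => //.
  by case: GG' => v vP; exists v => i j iv jv; rewrite vP.
move=> /node_neighbors_degree [v degv].
have etaE : 2 * (eps / 8) / W%:R = eps / (4 * W%:R) :> R.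
  by field; rewrite gt_eqF.
(* With [lam = 4 * L / eps] the gain [lam * (eps / 2)] is [2 * L]: one [L] absorbs the moment bound,
   the other leaves [expR (- L) = delta]. *)
apply: le_trans (@rr_prod_indist R n _
  (fun i => wave W (eps / 8) (rho i) #|nbhd G' i|) v
  (2 * (eps / 8) / W%:R) eps (4 * L / eps) E (ltW e0) e1 _ _ _ _ _ _) _ => //.
- by move=> i /degv[? ?]; exact: normr_wave_sub.
- by rewrite divr_ge0 //; lra.
- by rewrite divr_ge0 //; lra.
- rewrite etaE (_ : 4 * L / eps * _ = L / W%:R); last first.
    by field; rewrite !gt_eqF.
  by rewrite ler_pdivrMr //; lra.
rewrite lerD2l -[leRHS](@lnK R) ?posrE // ler_expR.
have -> : ln delta = - L by rewrite /L lnV ?posrE ?opprK.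
rewrite etaE (_ : _ - _ = 2 * L * (eps + 4 * L) * n%:R / W%:R ^+ 2 - 2 * L); last first.
  by field; rewrite !gt_eqF.
(* This is where [16 * n * L <= W ^+ 2] enters, together with [eps <= 1 <= 2 * L]. *)
suff : 2 * L * (eps + 4 * L) * n%:R / W%:R ^+ 2 <= L by lra.
rewrite ler_pdivrMr ?exprn_gt0 // -!mulrA [2 * _]mulrCA ler_wpM2l //; first by lra.
apply: le_trans nLW.
have n0 : 0 <= (n%:R : R) by [].
have : 2 * (eps + 4 * L) * n%:R <= 16 * L * n%:R by rewrite ler_wpM2r //; lra.
lra.
Qed.

(** * Correctness of the decoder, given the deviation bounds *)

(** For fixed [b], the drifts at [k'] and [k] differ by [alpha / W * (k' - k) * (k' + k - 1 - b *
    W)]. The last factor is at least [n / 20], so drifts within [64 * sqrt n] of each other force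
    [k'] close to [k]; [1280 = 64 * 20]. *)
Lemma decode_correct {R : realType} (n W k : nat) (alpha : R) (S : nat -> R) :
  let b0 := (k.-1 %/ W)%N in
  (100 <= n)%N -> (k <= n)%N -> (n <= 10 * k)%N -> (0 < W)%N -> (100 * W <= n)%N ->
  0 < alpha ->
  (forall b, (0 < b <= n.+1)%N -> b != b0 -> b != b0.+1 -> S b < alpha * n%:R / 40) ->
  (forall b, b = b0 \/ b = b0.+1 ->
     `|S b.+1 - S b.-1 - drift W alpha b k| <= 32 * Num.sqrt n%:R) ->
  (alpha * n%:R / 40 <= S b0 \/ alpha * n%:R / 40 <= S b0.+1) ->
  `|decode n W alpha S - k%:R| <= 1280 * W%:R / (alpha * Num.sqrt n%:R).
Proof.
move=> b0 n100 kn nk W0 Wn a0 Hfar Hnear Htop.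
have b0_gt0 : (0 < b0)%N by rewrite divn_gt0 //; lia.
have b0n : (b0.+1 <= n.+1)%N.
  by rewrite ltnS; apply: leq_trans (leq_div _ _) _; lia.
(* The true [k], paired with whichever of the two knots passes the threshold, is plausible, so the
   default is never returned. *)
have true_plausible : exists p : 'I_n.+2 * 'I_n.+1, plausible n W alpha S p.1 p.2.
  have ok b : b = b0 \/ b = b0.+1 -> alpha * n%:R / 40 <= S b ->
      exists p : 'I_n.+2 * 'I_n.+1, plausible n W alpha S p.1 p.2.
    move=> bb Sb; have bn : (b < n.+2)%N by case: bb; lia.
    have kn1 : (k < n.+1)%N by lia.
    exists (Ordinal bn, Ordinal kn1); rewrite /plausible /= nk Sb Hnear // !andbT.
    by case: bb; lia.
  by case: Htop; apply: ok; [left|right].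
rewrite /decode; case: pickP => [[b k'] /= pl|none]; last first.
  by case: true_plausible => p; rewrite none.
case/and4P: pl => b_gt0 nk' Sb near'.
have bb : b = b0 :> nat \/ b = b0.+1 :> nat.
  have [->|bb0] := eqVneq (b : nat) b0; first by left.
  have [->|bb1] := eqVneq (b : nat) b0.+1; first by right.
  have := Hfar b _ bb0 bb1; rewrite b_gt0 -ltnS ltn_ord => /(_ isT).
  by rewrite ltNge Sb.
have near := Hnear b bb.
have WR : 0 < (W%:R : R) by rewrite ltr0n.
have nR : 0 < (n%:R : R) by rewrite ltr0n; lia.
have bW : (b%:R * W%:R : R) <= k%:R - 1 + W%:R.
  have h : (b * W <= k.-1 + W)%N.
    apply: leq_trans (_ : b0.+1 * W <= _)%N; first by rewrite leq_mul2r; case: bb; lia.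
    by rewrite mulSn addnC leq_add2r leq_trunc_div.
  rewrite -natrM -(ler_nat R) natrD in h *.
  by rewrite (_ : (k%:R : R) = k.-1%:R + 1) ?addrK // natr1 prednK //; lia.
(* [b * W] exceeds [k - 1] by at most [W <= n / 100], while [k' >= n / 10]. *)
have slope : n%:R / 20 <= k'%:R + k%:R - 1 - b%:R * W%:R :> R.
  have h1 : (n%:R : R) <= 10 * k'%:R by rewrite -natrM ler_nat.
  have h2 : (100 * W%:R : R) <= n%:R by rewrite -natrM ler_nat.
  have : (k'%:R + k%:R : R) - 1 - b%:R * W%:R >= k'%:R - W%:R by lra.
  lra.
have close : `|drift W alpha b k' - drift W alpha b k| <= 64 * Num.sqrt n%:R.
  have -> : drift W alpha b k' - drift W alpha b k
    = (S b.+1 - S b.-1 - drift W alpha b k)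
      - (S b.+1 - S b.-1 - drift W alpha b k') by ring.
  by apply: le_trans (ler_normB _ _) _; lra.
have sn : 0 < Num.sqrt (n%:R : R) by rewrite sqrtr_gt0.
have snn : Num.sqrt (n%:R : R) * Num.sqrt n%:R = n%:R.
  by rewrite -expr2 sqr_sqrtr // ltW.
rewrite ler_pdivlMr ?mulr_gt0 //.
have driftE : drift W alpha b k' - drift W alpha b k
  = alpha / W%:R * ((k'%:R - k%:R) * (k'%:R + k%:R - 1 - b%:R * W%:R)).
  by rewrite /drift; field; rewrite gt_eqF.
move: close; rewrite driftE !normrM (ger0_norm (ltW a0)) normfV (ger0_norm (ltW WR)).
set d := `|_ - _|; set s := `|_ - _| => close.
have sn20 : n%:R / 20 <= s by apply: le_trans slope _; exact: ler_norm.
have d_ge0 : 0 <= d by exact: normr_ge0.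
have : alpha / W%:R * (d * (n%:R / 20)) <= 64 * Num.sqrt n%:R.
  apply: le_trans close; rewrite ler_wpM2l ?divr_ge0 ?(ltW a0) //.
  by rewrite ler_wpM2l.
move: (Num.sqrt _) sn snn => sq sn snn.
rewrite mulrAC ler_pdivrMr // -snn.
by move=> h; rewrite -(ler_pM2r sn); lra.
Qed.

(** * Accuracy on cliques *)

(** Union bound and Markov's inequality in one: wherever [P] fails some exponent is nonnegative, so
    the sum of exponentials is at least 1. *)
Lemma expect_union {R : realType} {n : nat} {T : finType} (q : 'I_n -> T -> R)
    (P : {ffun 'I_n -> T} -> {ffun 'I_n -> bool} -> bool)
    (s : seq ({ffun 'I_n -> T} -> {ffun 'I_n -> bool} -> R)) :
  (0 < #|T|)%N -> (forall i r, `|q i r| <= 1) ->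
  (forall rho y, all (fun x => x rho y < 0) s -> P rho y) ->
  1 - \sum_(x <- s) expect q (fun rho y => expR (x rho y))
  <= expect q (fun rho y => (P rho y)%:R).
Proof.
move=> T0 q1 sP.
rewrite -(expect_sum q _ s predT (fun x rho y => expR (x rho y))).
rewrite -[X in X - _](expect_cst q 1 T0) -expectB; apply: expect_le => // rho y.
have sum0 (u : seq ({ffun 'I_n -> T} -> {ffun 'I_n -> bool} -> R)) :
    0 <= \sum_(x <- u) expR (x rho y).
  by apply: sumr_ge0 => x _; exact: expR_ge0.
case Prho: (P rho y) => /=; first by rewrite mulr1n lerBlDr lerDl.
rewrite mulr0n subr_le0; have : ~~ all (fun x => x rho y < 0) s.
  by apply/negP => /sP; rewrite Prho.
elim: s {sP} => //= x s IH; rewrite big_cons negb_and -leNgt => /orP[x0|/IH h].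
  by apply: le_trans (expR_ge1 _ x0) _; rewrite lerDl.
by apply: le_trans h _; rewrite lerDr expR_ge0.
Qed.

Lemma expRN8_le {R : realType} : expR (-8) <= (2 ^+ 8)^-1 :> R.
Proof.
rewrite expRN lef_pV2 ?posrE ?expR_gt0 ?exprn_gt0 //.
have -> : (8 : R) = 8%:R * 1 by rewrite mulr1.
rewrite expRM_natl lerXn2r ?nnegrE ?expR_ge0 //.
by have := expR_ge1Dx (1 : R); lra.
Qed.

Lemma wave_alg_accuracy {R : realType} (n W : nat) (alpha : R) (K : {set 'I_n}) :
  (100 <= n)%N -> (n <= 10 * #|K|)%N -> (0 < W)%N -> (100 * W <= n)%N ->
  0 < alpha -> alpha <= 1 -> 640 ^+ 2 * ln (n%:R : R) <= alpha ^+ 2 * n%:R ->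
  2 / 3 <= out_prob (wave_alg R n W alpha) (clique_graph K)
    (fun x => `|x - #|K|%:R| <= 1280 * W%:R / (alpha * Num.sqrt n%:R)).
Proof.
move=> n100 nk W0 Wn a0 a1 gap.
have kn : (#|K| <= n)%N by rewrite -[n in X in (_ <= X)%N]card_ord max_card.
set k := #|K| in nk kn *; pose b0 := (k.-1 %/ W)%N.
(* At least 2, so that [b0.-1] is positive and neither difference involves knot 0. *)
have b0_gt1 : (1 < b0)%N by rewrite leq_divRL //; lia.
have b0n : (b0.+1 <= n)%N.
  by apply: leq_ltn_trans (leq_div _ _) _; lia.
have r1 : (0 < b0.+1 <= n.+2)%N by lia.
have r2 : (0 < b0.-1 <= n.+2)%N by lia.
have r3 : (0 < b0.+2 <= n.+2)%N by lia.
have r4 : (0 < b0 <= n.+2)%N by lia.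
have kE : (k%:R : R) - 1 = k.-1%:R.
  by rewrite -[in LHS](@prednK k) -?natr1 ?addrK //; lia.
have nR : 0 < (n%:R : R) by rewrite ltr0n; lia.
pose sq : R := Num.sqrt n%:R.
have sqn : sq ^+ 2 = n%:R by rewrite sqr_sqrtr // ltW.
have sq10 : 10 <= sq.
  rewrite -(@ler_sqr R) ?nnegrE ?sqrtr_ge0 // sqn -natrX ler_nat; lia.
pose theta := alpha * n%:R / 40; pose tau := 32 * sq.
(* These minimize [32 * lam ^+ 2 * n - lam * t] for [t = theta] and [t = tau]; the minima are
   [- alpha ^+ 2 * n / (320 * 640)] and [-8]. *)
pose l1 := alpha / (64 * 40); pose l2 := (2 * sq)^-1.
have l2_gt0 : 0 < l2 by rewrite invr_gt0; lra.
have l1_gt0 : 0 < l1 by rewrite /l1; lra.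
pose dev (lam a a' : R) (c c' : nat) (t : R)
    (rho : {ffun 'I_n -> {ffun 'I_n.+3 -> bool}}) (y : {ffun 'I_n -> bool}) :=
  lam * (a * corr rho y c + a' * corr rho y c'
         - k%:R * (alpha * (a * hat W c k.-1 + a' * hat W c' k.-1)) - t).
(* The weights of the two knots around [k - 1] sum to 1, so one of them is at least a half. *)
pose bt := if 2^-1 <= (hat W b0 k.-1 : R) then b0 else b0.+1.
pose far b := (b != b0) && (b != b0.+1).
(* The bad events: a far correlation reaches [theta]; one of the two differences strays by [tau], in
   either direction; the correlation at [bt] falls [theta] below its mean. *)
pose s := [seq dev l1 1 0 b b theta | b <- index_iota 1 n.+2 & far b]
  ++ [:: dev l2 1 (-1) b0.+1 b0.-1 tau; dev l2 (-1) 1 b0.+1 b0.-1 tau;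
         dev l2 1 (-1) b0.+2 b0 tau; dev l2 (-1) 1 b0.+2 b0 tau;
         dev l1 (-1) 0 bt bt theta].
have bt_b0 : bt = b0 \/ bt = b0.+1 by rewrite /bt; case: ifP; [left|right].
have hat_bt : 2^-1 <= (hat W bt k.-1 : R).
  rewrite /bt; case: ifPn => //; rewrite -ltNge /hat -/b0 !eqxx.
  rewrite (ltn_eqF (ltnSn b0)) (gtn_eqF (ltnSn b0)) /= !mulr0 !mulr1 addr0 add0r; lra.
rewrite out_prob_wave_alg.
have seed0 : (0 < #|{ffun 'I_n.+3 -> bool}|)%N.
  by rewrite card_ffun card_bool expn_gt0.
have bias1 i (r : {ffun 'I_n.+3 -> bool}) :
    `|wave_bias W alpha (clique_graph K) i r| <= 1.
  by apply: le_trans a1; apply: normr_wave => //; exact: ltW.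
apply: le_trans (expect_union _ _ s seed0 bias1 _); last first.
  move=> rho y; rewrite all_cat => /andP[/allP devfar].
  rewrite /= /dev !pmulr_rlt0 // => /and5P[d1 d2 d3 d4 /andP[d5 _]].
  apply: decode_correct => //.
  - move=> b bn bb0 bb1.
    have : dev l1 1 0 b b theta rho y < 0.
      apply: devfar; apply: (map_f (fun b => dev l1 1 0 b b theta)).
      by rewrite mem_filter /far bb0 bb1 mem_index_iota.
    by rewrite /dev pmulr_rlt0 // hat_far // !mulr0 addr0 mulr0 mulr0 mul0r mul1r /theta; lra.
  - have driftE b : b = b0 \/ b = b0.+1 ->
        drift W alpha b k = k%:R * (alpha * (hat W b.+1 k.-1 - hat W b.-1 k.-1)).
      move=> bb; rewrite hat_diff //; last by case: bb => ->; [exact: ltnW|].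
      by rewrite /drift kE; ring.
    move=> b bb; rewrite driftE // ler_norml -/sq -/tau.
    by case: bb => ->; apply/andP; split; move: d1 d2 d3 d4; rewrite /=; lra.
  (* The mean at [bt] is at least [alpha * k / 2 >= alpha * n / 20 = 2 * theta], so a loss of
     [theta] leaves [theta]. *)
  - have kR : (n%:R : R) <= 10 * k%:R by rewrite -natrM ler_nat.
    have : 2^-1 * (alpha * k%:R) <= hat W bt k.-1 * (alpha * k%:R).
      by rewrite ler_wpM2r // mulr_ge0 // ltW.
    have : alpha * n%:R <= alpha * (10 * k%:R) by rewrite ler_wpM2l // ltW.
    by move: d5; rewrite /theta; case: bt_b0 => ->; [left|right]; lra.
have dev_le lam a a' c c' t : (0 < c <= n.+2)%N -> (0 < c' <= n.+2)%N ->
    `|a| + `|a'| <= 2 -> 0 <= lam -> lam <= 8^-1 ->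
    expect (wave_bias W alpha (clique_graph K))
      (fun rho y => expR (dev lam a a' c c' t rho y))
    <= expR (32 * lam ^+ 2 * n%:R - lam * t).
  by move=> *; apply: clique_chernoff => //; exact: ltW.
have l1_le : l1 <= 8^-1 by rewrite /l1; lra.
have l2_le : l2 <= 8^-1 by rewrite lef_pV2 ?posrE; lra.
(* By [gap] the exponent is at most [-2 * ln n], small enough for a union bound over all knots. *)
have bound1 a b : `|a| = 1 -> (0 < b <= n.+2)%N ->
    expect (wave_bias W alpha (clique_graph K))
      (fun rho y => expR (dev l1 a 0 b b theta rho y)) <= (n%:R ^+ 2)^-1.
  move=> a_1 bn; apply: le_trans (dev_le _ _ _ _ _ _ bn bn _ (ltW l1_gt0) l1_le) _.
    by rewrite a_1 normr0; lra.
  rewrite -[leRHS]lnK ?posrE ?invr_gt0 ?exprn_gt0 // ler_expR.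
  rewrite lnV ?posrE ?exprn_gt0 // lnXn // /l1 /theta.
  rewrite (_ : _ - _ = - (alpha ^+ 2 * n%:R / (320 * 640))); last by field.
  by rewrite lerN2 mulr2n; lra.
have bound2 a c c' : `|a| = 1 -> (0 < c <= n.+2)%N -> (0 < c' <= n.+2)%N ->
    expect (wave_bias W alpha (clique_graph K))
      (fun rho y => expR (dev l2 a (- a) c c' tau rho y)) <= (2 ^+ 8)^-1.
  move=> a_1 cn c'n; apply: le_trans (dev_le _ _ _ _ _ _ cn c'n _ (ltW l2_gt0) l2_le) _.
    by rewrite normrN a_1; lra.
  rewrite -sqn /l2 /tau (_ : _ - _ = -8); first exact: expRN8_le.
  by field; rewrite gt_eqF //; lra.
rewrite big_cat !big_cons big_nil big_map big_filter /= ?addr0.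
have N1 : `|1 : R| = 1 by rewrite normr1.
have N1' : `|-1 : R| = 1 by rewrite normrN1.
have h1 := bound2 1 b0.+1 b0.-1 N1 r1 r2.
have h2 := bound2 (-1) b0.+1 b0.-1 N1' r1 r2.
have h3 := bound2 1 b0.+2 b0 N1 r3 r4.
have h4 := bound2 (-1) b0.+2 b0 N1' r3 r4.
rewrite opprK in h2 h4.
have h5 : (0 < bt <= n.+2)%N by case: bt_b0 => ->.
have {}h5 := bound1 (-1) bt N1' h5.
have h6 : \sum_(1 <= b < n.+2 | far b)
    expect (wave_bias W alpha (clique_graph K))
      (fun rho y => expR (dev l1 1 0 b b theta rho y)) <= n.+1%:R * (n%:R ^+ 2)^-1.
  rewrite big_mkcond /= mulr_natl [X in _ *+ X](_ : n.+1 = (n.+2 - 1)%N); last by rewrite subn1.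
  rewrite -sumr_const_nat; apply: ler_sum_nat => b /andP[b1 bn].
  case: ifP => _; last by rewrite invr_ge0 exprn_ge0.
  by apply: bound1 => //; rewrite b1 ltnW.
(* With the four difference events at [2 ^- 8] each, the total failure probability stays below
   1/3. *)
have small : n.+1%:R * (n%:R ^+ 2)^-1 + (n%:R ^+ 2)^-1 <= 10^-1 :> R.
  rewrite -natr1 mulrDl mul1r expr2 invfM mulrA mulfV ?gt_eqF // mul1r.
  have n1 : (n%:R : R)^-1 <= 100^-1.
    by rewrite lef_pV2 ?posrE // (ler_nat R 100).
  have n0 : 0 <= (n%:R : R)^-1 by rewrite invr_ge0.
  nra.
lra.
Qed.

(** * Choice of parameters and conclusion *)

Lemma expR_half_le2 {R : realType} : expR (2^-1 : R) <= 2.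
Proof. by apply: le_trans (expR_le_quad _ (lexx _)) _; lra. Qed.

(* The knot spacing W is sqrt (n * L), with L = ln (1 / delta), up to constants. *)
Lemma knot_spacing {R : realType} (n : nat) (eps L : R) :
  (100 <= n)%N -> 0 < eps -> eps <= 1 -> 2^-1 <= L ->
  80 * 100 * Num.sqrt (ln (n%:R : R) * L / n%:R) <= eps ->
  640 ^+ 2 * ln (n%:R : R) <= (eps / 8) ^+ 2 * n%:R /\
  exists W : nat, [/\ (0 < W)%N, (100 * W <= n)%N,
    4 * L <= W%:R, 16 * n%:R * L <= W%:R ^+ 2
    & W%:R <= 8 * (Num.sqrt n%:R * Num.sqrt L)].
Proof.
move=> n100 e0 e1 L2.
have nR : 100 <= (n%:R : R) by rewrite (ler_nat R 100).
have n_gt0 : 0 < (n%:R : R) by apply: lt_le_trans nR; rewrite ltr0n.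
set N := ln _ => hc.
have N1 : 1 <= N.
  rewrite -ler_expR lnK ?posrE // (_ : 1 = 2^-1 + 2^-1 :> R); last by lra.
  have h := @expR_half_le2 R; have h0 := expR_ge0 (2^-1 : R).
  by rewrite expRD; nra.
pose sn : R := Num.sqrt n%:R; pose sL : R := Num.sqrt L.
have snE : sn ^+ 2 = n%:R by rewrite sqr_sqrtr // ltW.
have sLE : sL ^+ 2 = L by rewrite sqr_sqrtr //; lra.
have sn0 : 0 <= sn := sqrtr_ge0 _.
have sL0 : 0 <= sL := sqrtr_ge0 _.
have sn10 : 10 <= sn by nra.
have sL2 : 2^-1 <= sL by nra.
(* The square of the hypothesis on [eps], with [(80 * 100) ^+ 2] lowered to [640 ^+ 2 * 128]. *)
have key : 640 ^+ 2 * 128 * (N * L) <= eps ^+ 2 * n%:R.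
  have NL0 : 0 <= N * L by rewrite mulr_ge0; lra.
  have : (80 * 100) ^+ 2 * (N * L / n%:R) <= eps ^+ 2.
    rewrite -[N * L / _]sqr_sqrtr ?divr_ge0 ?(ltW n_gt0) // -exprMn.
    by rewrite lerXn2r ?nnegrE ?mulr_ge0 ?sqrtr_ge0 ?(ltW e0).
  rewrite mulrA ler_pdivrMr // => h; apply: le_trans h.
  by rewrite ler_wpM2r //; lra.
(* This makes [W], of order [sn * sL], small against [n] and large against [L]. *)
have sL_sn : 80 * 80 * sL <= sn.
  rewrite -(@ler_sqr R) ?nnegrE ?mulr_ge0 // exprMn sLE snE.
  have LNL : L <= N * L by rewrite ler_peMl //; lra.
  have : eps ^+ 2 * n%:R <= n%:R.
    by rewrite ler_piMl ?(ltW n_gt0) // expr_le1 // ltW.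
  lra.
(* The successor ensures [4 * (sn * sL) < W]; as [sn * sL >= 5], the added 1 is absorbed in the
   factor 8 of the upper bound. *)
pose W := (Num.trunc (4 * (sn * sL))).+1.
have x5 : 5 <= sn * sL by nra.
have W_gt : 4 * (sn * sL) < W%:R by exact: truncnS_gt.
have W_le : W%:R <= 8 * (sn * sL).
  have : (Num.trunc (4 * (sn * sL)))%:R <= 4 * (sn * sL) by rewrite truncn_le; lra.
  by rewrite /W -natr1; lra.
split.
  have : 2^-1 * N <= N * L by rewrite mulrC ler_wpM2l //; lra.
  lra.
exists W; split=> //.
- rewrite -(ler_nat R) natrM -snE; nra.
- by apply: le_trans (ltW W_gt); rewrite -sLE; nra.
- rewrite -snE -sLE (_ : 16 * _ * _ = (4 * (sn * sL)) ^+ 2); last by ring.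
  by rewrite lerXn2r ?nnegrE ?mulr_ge0 // ltW.
Qed.

Theorem theorem4p9 (R : realType) :
  exists (c C : R) (n0 : nat), 0 < c /\ 0 < C /\
  forall (n : nat) (delta eps : R),
    (n0 <= n)%N ->
    0 < delta -> delta <= 2^-1 ->
    0 < eps -> eps <= 1 ->
    c * Num.sqrt (ln (n%:R : R) * ln (delta^-1) / n%:R) <= eps ->
    exists A : local_alg R n,
      LNDP A eps delta /\
      forall K : {set 'I_n},
        (n%:R : R) <= 10 * (#|K|%:R : R) ->
        2 / 3 <= out_prob A (clique_graph K)
                   (fun a => `|a - (#|K|%:R : R)| <= C * Num.sqrt (ln (delta^-1)) / eps).
Proof.
(* [400 ^+ 2] exceeds [1280 * 8 * 8]: the decoding constant, the factor in the bound on [W], and the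
   8 in [alpha = eps / 8]. *)
exists (80 * 100), (400 ^+ 2), 100%N; split; first by lra.
split; first by lra.
move=> n delta eps n100 d0 d2 e0 e1 hc.
have L2 : 2^-1 <= ln (delta^-1).
  rewrite -ler_expR lnK ?posrE ?invr_gt0 //; apply: le_trans expR_half_le2 _.
  by rewrite -[leLHS]invrK lef_pV2 ?posrE.
have [gap [W [W0 Wn LW nLW W_le]]] := knot_spacing _ _ _ n100 e0 e1 L2 hc.
exists (wave_alg R n W (eps / 8)); split; first exact: wave_alg_LNDP.
move=> K; rewrite -natrM ler_nat => nk.
have a0 : 0 < eps / 8 by lra.
have a1 : eps / 8 <= 1 by lra.
have bound : 1280 * W%:R / (eps / 8 * Num.sqrt n%:R)
    <= 400 ^+ 2 * Num.sqrt (ln (delta^-1)) / eps.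
  move: W_le; set sn := Num.sqrt n%:R; set sL := Num.sqrt _ => W_le.
  have sn0 : 0 < sn by rewrite sqrtr_gt0 ltr0n (leq_trans _ n100).
  have sL0 : 0 <= sL := sqrtr_ge0 _.
  rewrite ler_pdivrMr ?mulr_gt0 //.
  rewrite (_ : _ / eps * _ = 20 * 1000 * (sn * sL)); last by field; rewrite gt_eqF.
  have : 0 <= sn * sL by rewrite mulr_ge0 // ltW.
  lra.
(* The decoding error bound is below the claimed one, so the probability can only grow. *)
apply: le_trans (wave_alg_accuracy _ _ _ K n100 nk W0 Wn a0 a1 gap) _.
rewrite !out_prob_wave_alg; apply: expect_le => [i r|rho y].
  by apply: le_trans a1; apply: normr_wave => //; exact: ltW.
rewrite ler_nat; set dist := `|_ - _|.
by have [h|] := leP dist (1280 * W%:R / (eps / 8 * Num.sqrt n%:R));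
  first rewrite (le_trans h bound).
Qed.
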